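(* Let $(X,T)$ be a topological space and let $(K,L)$ be a Hausdorff compactification of $(X,T)$, that is, a compact Hausdorff space together with a continuous map $\psi:(X,T)\to(K,L)$ such that $\psi[X]$ is dense in $(K,L)$. Let $\Phi=\{f\circ\psi: f\in C(K,\mathbb R)\}$ and let $(\widehat X,\widehat T)$ be the nonstandard $\Phi$-hull of $(X,T)$. Then $(\widehat X,\widehat T)$ and $(K,L)$ are homeomorphic.
   Context: Nonstandard setting. Let $S\supseteq X\cup K\cup\mathbb R$ be a set of individuals, with superstructure $V(S)=\bigcup_{k\ge 0}V_k(S)$, $V_0(S)=S$, $V_{k+1}(S)=V_k(S)\cup\mathcal P(V_k(S))$. A $\kappa$-saturated nonstandard model of $S$ is a superstructure $V({}^*S)$ with a map $A\mapsto {}^*A$ from $V(S)$ into $V({}^*S)$ satisfying: (Extension) ${}^*s=s$ for all $s\in S$; (Transfer) a bounded quantifier formula $\Theta(A_1,\dots,A_n)$ with constants in $V(S)$ is true iff $\Theta({}^*A_1,\dots,{}^*A_n)$ is true in $V({}^*S)$; (Saturation) every family of at most $\kappa$ internal sets with the finite intersection property has nonempty intersection. An entity of $V({}^*S)$ is internal if it is an element of ${}^*A$ for some $A\in V(S)$. Throughout, a $\kappa$-saturated model with $\kappa$ infinite and $\kappa>\max(\operatorname{card}T,\operatorname{card}L)$ is fixed; $X\subseteq {}^*X$. The standard topology ${}^sT$ on ${}^*X$ has base $\{{}^*G:G\in T\}$. $C(K,\mathbb R)$ is the set of continuous real-valued functions on $K$. In ${}^*\mathbb R$: $\xi$ is finite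 if $|\xi|<n$ for some $n\in\mathbb N$; $\xi\approx\eta$ if $|\xi-\eta|<1/n$ for all $n\in\mathbb N$. For a set $\Phi$ of continuous real-valued functions on $X$: $\widetilde X_\Phi=\{\alpha\in{}^*X: {}^*g(\alpha)\text{ is finite for all } g\in\Phi\}$ with the subspace topology from $({}^*X,{}^sT)$ (if all members of $\Phi$ are bounded, as here, $\widetilde X_\Phi={}^*X$); $\alpha\sim_\Phi\beta$ iff ${}^*g(\alpha)\approx{}^*g(\beta)$ for all $g\in\Phi$; the nonstandard $\Phi$-hull is $\widehat X=\widetilde X_\Phi/\!\sim_\Phi$ with the quotient topology $\widehat T$. *)

(* Defs.v *)
From HB Require Import structures.
From mathcomp Require Import all_boot all_order all_algebra.
From mathcomp Require Import all_classical all_reals.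
From mathcomp Require Import topology normedtype.
From mathcomp Require Import zify.

Set Implicit Arguments.
Unset Strict Implicit.
Unset Printing Implicit Defensive.

Import Order.TTheory GRing.Theory Num.Theory.
Import numFieldNormedType.Exports.

Local Open Scope classical_set_scope.

(* The superstructure V(S) over a type S of individuals.  An individual has no
   members, hence V_{k+1}(S) = V_k(S) `|` P(V_k(S)) is the disjoint union of S
   and of P(V_k(S)); this is level_type.  The inclusion of V_k(S) into
   V_{k+1}(S) is up, and V(S) is the union of the V_k(S) along these
   inclusions; the lemmas level0, levelS and bigcup_level below state this in
   terms of the membership relation of V(S). *)
Section Superstructure.
Variable S : Type.

Fixpoint level_type (k : nat) : Type :=
  if k is k'.+1 then (S + set (level_type k'))%type else S.

Fixpoint up (k : nat) : level_type k -> level_type k.+1 :=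
  match k return level_type k -> level_type k.+1 with
  | 0 => fun s => inl s
  | k'.+1 => fun x =>
      match x with
      | inl s => inl s
      | inr A => inr (@up k' @` A)
      end
  end.

Definition fresh (k : nat) : set (level_type k) :=
  match k return set (level_type k) with
  | 0 => setT
  | k'.+1 => ~` range (@up k')
  end.

(* An element of V(S) is given by the least k such that it lies in V_k(S)
   together with its representative in V_k(S), so that the equality of V(S) is
   Leibniz equality. *)
Definition superstructure : Type :=
  {k : nat & {x : level_type k | fresh x}}.

HB.instance Definition _ := gen_eqMixin superstructure.
HB.instance Definition _ := gen_choiceMixin superstructure.

Local Notation V := superstructure.

(* The inclusion of V_k(S) into V(S). *)
Fixpoint inclV (k : nat) : level_type k -> V :=
  match k return level_type k -> V with
  | 0 => fun s => existT _ 0 (exist _ s I)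
  | k'.+1 => fun x =>
      match pselect (range (@up k') x) with
      | left xup => inclV (s2val (cid2 xup))
      | right xnew => existT _ k'.+1 (exist _ x xnew)
      end
  end.

Definition level (k : nat) : set V := range (@inclV k).

Definition individual (s : S) : V := @inclV 0 s.

Definition is_set (A : V) : Prop := ~ range individual A.

Definition memV (x A : V) : Prop :=
  exists k (y : level_type k) (B : set (level_type k)),
    [/\ x = inclV y, A = @inclV k.+1 (inr B) & B y].

Definition elements (A : V) : set V := [set x | memV x A].

Definition emptyV : V := @inclV 1 (inr set0).

(* The element of V(S) whose members are the elements of P; it exists when P is
   contained in some V_k(S), and is the empty set by convention otherwise. *)
Definition collect (P : set V) : V :=
  xget emptyV [set A | is_set A /\ elements A = P].

Definition upair (x y : V) : V := collect [set x; y].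

Definition opair (x y : V) : V := upair (upair x x) (upair x y).

(* Value at x of a function given by its graph. *)
Definition appV (F x : V) : V := xget emptyV [set y | memV (opair x y) F].

Lemma up_inj k : injective (@up k).
Proof.
elim: k => [x y [] //|k IH] [s|A] [t|B] //=; first by case=> ->.
move=> [AB]; congr inr; apply/seteqP; split=> x Ax.
  have : (@up k @` B) (up x) by rewrite -AB; exists x.
  by case=> y By /IH <-.
have : (@up k @` A) (up x) by rewrite AB; exists x.
by case=> y By /IH <-.
Qed.

Lemma incl_up k (x : level_type k) : inclV (up x) = inclV x.
Proof.
rewrite [LHS]/=; case: pselect => [h|[]]; last by exists x.
by case: cid2 => y _ /= /up_inj yx; rewrite yx.
Qed.

Lemma incl_rank k (x : level_type k) : projT1 (inclV x) <= k.
Proof.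
elim: k x => [//|k IH] x; rewrite [inclV _]/=.
by case: pselect => // h; apply: leq_trans (IH _) _.
Qed.

Lemma incl_inj k : injective (@inclV k).
Proof.
have inj m (u v : {z : level_type m | fresh z}) :
    existT (fun m => {z : level_type m | fresh z}) m u = existT _ m v ->
    sval u = sval v.
  move=> e; have /= := projT2_eq e.
  by rewrite (eq_irrelevance (projT1_eq e) erefl) /= => ->.
elim: k => [|k IH] x y; first by move=> /inj.
rewrite /=.
case: pselect => [h|nx]; case: pselect => [h'|ny].
- case: cid2 => x' _ /= ex; case: cid2 => y' _ /= ey /IH xy.
  by rewrite -ex -ey xy.
- move=> /(congr1 (@projT1 _ _)) /= e.
  by have := incl_rank (s2val (cid2 h)); rewrite e ltnn.
- move=> /(congr1 (@projT1 _ _)) /= e.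
  by have := incl_rank (s2val (cid2 h')); rewrite -e ltnn.
- by move=> /inj.
Qed.

Lemma incl_surj (x : V) : exists k (y : level_type k), x = inclV y.
Proof.
case: x => k [y fy]; exists k, y; case: k y fy => [y [] //|k y fy] /=.
case: pselect => [/fy //|ny]; congr existT; congr exist; exact: Prop_irrelevance.
Qed.

Lemma levelW k : level k `<=` level k.+1.
Proof. by move=> _ [x _ <-]; exists (up x) => //; exact: incl_up. Qed.

Lemma level_le k m : k <= m -> level k `<=` level m.
Proof.
move=> /subnKC <-; elim: (m - k) => [|d IH]; first by rewrite addn0.
by rewrite addnS; exact: subset_trans IH (@levelW _).
Qed.

Lemma level_ex (x : V) : exists k, level k x.
Proof. by have [k [y ->]] := incl_surj x; exists k, y. Qed.

Lemma bigcup_level : \bigcup_k level k = setT.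
Proof.
by apply/seteqP; split=> // x _; have [k kx] := level_ex x; exists k.
Qed.

Lemma level_ex2 (x y : V) : exists2 k, level k x & level k y.
Proof.
have [k kx] := level_ex x; have [m my] := level_ex y.
exists (maxn k m); first exact: level_le (leq_maxl _ _) _ kx.
exact: level_le (leq_maxr _ _) _ my.
Qed.

Lemma incl_set_up k (B : set (level_type k)) :
  @inclV k.+2 (inr (@up k @` B)) = @inclV k.+1 (inr B).
Proof. exact: (@incl_up k.+1 (inr B)). Qed.

Lemma incl_lift k m (x : level_type k) (B : set (level_type k)) :
  k <= m -> exists (x' : level_type m) (B' : set (level_type m)),
    [/\ inclV x' = inclV x, @inclV m.+1 (inr B') = @inclV k.+1 (inr B)
      & B' x' <-> B x].
Proof.
move=> /subnKC <-; elim: (m - k) => [|d [y [C [yx CB CyBx]]]].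
  by rewrite addn0; exists x, B.
rewrite addnS; exists (up y), (@up _ @` C).
rewrite incl_up incl_set_up; split=> //; rewrite -CyBx.
by split=> [[z Cz /up_inj <-]//|Cy]; exists y.
Qed.

Lemma mem_incl k (x : level_type k) (B : set (level_type k)) :
  memV (inclV x) (@inclV k.+1 (inr B)) <-> B x.
Proof.
split; last by move=> Bx; exists k, x, B.
move=> [m [y [C [xy BC Cy]]]].
have [x' [B' [ex eB <-]]] := incl_lift x B (leq_maxl k m).
have [y' [C' [ey eC Cy']]] := incl_lift y C (leq_maxr k m).
have -> : x' = y' by apply: incl_inj; rewrite ex ey.
have [->] : inr B' = inr C' :> level_type (maxn k m).+1.
  by apply: incl_inj; rewrite eB eC.
exact/Cy'.
Qed.

Lemma incl_individual k s : @inclV k.+1 (inl s) = individual s.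
Proof.
elim: k => [|k IH]; first exact: (@incl_up 0 s).
by rewrite -IH; exact: (@incl_up k.+1 (inl s)).
Qed.

Lemma individual_inj : injective individual.
Proof. exact: (@incl_inj 0). Qed.

Lemma incl_is_set k (B : set (level_type k)) : is_set (@inclV k.+1 (inr B)).
Proof. by move=> [s _]; rewrite -(incl_individual k) => /incl_inj. Qed.

Lemma mem_individual x s : ~ memV x (individual s).
Proof.
by move=> [k [y [B [_ sB _]]]]; apply: (@incl_is_set k B); exists s.
Qed.

Lemma mem_is_set x A : memV x A -> is_set A.
Proof. by move=> [k [y [B [_ -> _]]]]; exact: incl_is_set. Qed.

Lemma is_setP A : is_set A ->
  exists k (B : set (level_type k)), A = @inclV k.+1 (inr B).
Proof.
move=> sA; have [[|k] [y Ay]] := incl_surj A.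
  by case: sA; exists y.
case: y Ay sA => [s|B] -> sA; last by exists k, B.
by case: sA; exists s => //; exact/esym/incl_individual.
Qed.

Lemma elements_incl k (B : set (level_type k)) :
  elements (@inclV k.+1 (inr B)) = @inclV k @` B.
Proof.
apply/seteqP; split=> x; last by move=> [y By <-]; exact/mem_incl.
move=> [m [y [C [-> BC Cy]]]].
have [z [D [ez eD Dz]]] := incl_lift y C (leq_maxr k m).
have {Dz Cy} /Dz Dz := Cy.
suff [B' eB'] : exists B' : set (level_type (maxn k m)),
    [/\ @inclV (maxn k m).+1 (inr B') = @inclV k.+1 (inr B)
    & @inclV _ @` B' = @inclV k @` B].
  have [eB <-] := eB'; exists z => //.
  have [->//] : inr B' = inr D :> level_type (maxn k m).+1.
  by apply: incl_inj; rewrite eB eD.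
have /subnKC <- := leq_maxl k m.
elim: (maxn k m - k) => [|d [B' [eB BB]]]; first by rewrite addn0; exists B.
rewrite addnS; exists (@up _ @` B'); split; first by rewrite incl_set_up.
rewrite -BB image_comp; congr image; apply: funext => w /=.
exact: (@incl_up _ w).
Qed.

Lemma set_ext A B : is_set A -> is_set B -> elements A = elements B -> A = B.
Proof.
move=> sA sB AB.
suff [k [C [D [-> -> CD]]]] : exists k (C D : set (level_type k)),
    [/\ A = @inclV k.+1 (inr C), B = @inclV k.+1 (inr D) & C = D].
  by rewrite CD.
have [k kA kB] := level_ex2 A B.
have h E : is_set E -> level k E ->
    exists C : set (level_type k), E = @inclV k.+1 (inr C).
  move=> sE /levelW [[s|C] _ eE]; last by exists C.
  by case: sE; exists s => //; rewrite -eE; exact/esym/incl_individual.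
move: (h _ sA kA) (h _ sB kB) => [C eC] [D eD].
exists k, C, D; split=> //; apply/seteqP; split=> x; rewrite -!mem_incl -eC -eD.
  by move=> xA; have : elements A (inclV x) by []; rewrite AB.
by move=> xB; have : elements B (inclV x) by []; rewrite -AB.
Qed.

Lemma collect_ex k (P : set V) : P `<=` level k ->
  exists2 A, level k.+1 A & is_set A /\ elements A = P.
Proof.
move=> Pk; exists (@inclV k.+1 (inr (@inclV k @^-1` P))); first by exists (inr (@inclV k @^-1` P)).
split; first exact: incl_is_set.
rewrite elements_incl; apply/seteqP; split=> [_ [x Px <-//]|x Px].
by have [y _ yx] := Pk _ Px; exists y => //=; rewrite yx.
Qed.

Lemma collectP k P : P `<=` level k ->
  is_set (collect P) /\ elements (collect P) = P.
Proof.
move=> /collect_ex[A _ AP].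
exact: (@xgetPex _ emptyV [set A | is_set A /\ elements A = P] (ex_intro _ A AP)).
Qed.

Lemma elements_collect k P : P `<=` level k -> elements (collect P) = P.
Proof. by move=> /collectP[]. Qed.

Lemma mem_collect k P x : P `<=` level k -> memV x (collect P) <-> P x.
Proof.
by move=> /elements_collect e; rewrite -[memV _ _]/(elements (collect P) x) e.
Qed.

Lemma level_collect k P : P `<=` level k -> level k.+1 (collect P).
Proof.
move=> Pk; have [A kA [sA AP]] := collect_ex Pk.
by have [sC CP] := collectP Pk; rewrite (set_ext sC sA) // CP AP.
Qed.

Lemma level0 : level 0 = range individual.
Proof. by []. Qed.

Lemma levelS k :
  level k.+1 = level k `|` [set A | is_set A /\ elements A `<=` level k].
Proof.
apply/seteqP; split=> [_ [[s|B] _ <-]|A].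
- left; rewrite incl_individual; apply: (@level_le 0) => //; exact/imageT.
- right; split; first exact: incl_is_set.
  by rewrite elements_incl => _ [x _ <-]; exists x.
- case=> [/levelW//|[sA Ak]]; have [B kB [sB BA]] := collect_ex Ak.
  by rewrite (set_ext sA sB).
Qed.

Lemma mem_upair x y z : memV z (upair x y) <-> z = x \/ z = y.
Proof.
have [k kx ky] := level_ex2 x y.
by apply: (@mem_collect k) => _ [] ->.
Qed.

Lemma upair_is_set x y : is_set (upair x y).
Proof. by apply: (@mem_is_set x); apply/mem_upair; left. Qed.

Lemma level_upair k x y : level k x -> level k y -> level k.+1 (upair x y).
Proof. by move=> kx ky; apply: level_collect => _ [] ->. Qed.

Lemma level_opair k x y : level k x -> level k y -> level k.+2 (opair x y).
Proof. by move=> kx ky; do !apply: level_upair. Qed.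

Lemma upair_inj a b c d : upair a b = upair c d ->
  (a = c /\ b = d) \/ (a = d /\ b = c).
Proof.
move=> e.
have /mem_upair ha : memV a (upair c d) by rewrite -e; apply/mem_upair; left.
have /mem_upair hb : memV b (upair c d) by rewrite -e; apply/mem_upair; right.
have /mem_upair hc : memV c (upair a b) by rewrite e; apply/mem_upair; left.
have /mem_upair hd : memV d (upair a b) by rewrite e; apply/mem_upair; right.
by move: ha hb hc hd => [|] -> [|] -> [|] ? [|] ?; (left + right).
Qed.

Lemma opair_inj x y x' y' : opair x y = opair x' y' -> x = x' /\ y = y'.
Proof.
move=> /upair_inj[[/upair_inj h /upair_inj k]|[/upair_inj h /upair_inj k]];
  by case: h => -[? ?]; case: k => -[? ?]; split; congruence.
Qed.

End Superstructure.

(* Bounded quantifier formulas in the language of membership and equality; the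
   free variables stand for the constants A_1, ..., A_n.  In fAll i b phi and
   fEx i b phi the variable i is bound and ranges over the members of (the
   value of) the variable b. *)
Inductive formula : Type :=
  | fEq of nat & nat
  | fMem of nat & nat
  | fNot of formula
  | fAnd of formula & formula
  | fOr of formula & formula
  | fImp of formula & formula
  | fAll of nat & nat & formula
  | fEx of nat & nat & formula.

Definition assign (T : Type) (e : nat -> T) (i : nat) (x : T) : nat -> T :=
  fun j => if j == i then x else e j.

Fixpoint sat (S : Type) (e : nat -> superstructure S) (phi : formula) : Prop :=
  match phi with
  | fEq i j => e i = e j
  | fMem i j => memV (e i) (e j)
  | fNot p => ~ sat e p
  | fAnd p q => sat e p /\ sat e q
  | fOr p q => sat e p \/ sat e q
  | fImp p q => sat e p -> sat e q
  | fAll i b p => forall x, memV x (e b) -> sat (assign e i x) p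
  | fEx i b p => exists2 x, memV x (e b) & sat (assign e i x) p
  end.

(* starS is the set of individuals of V( *S ), that is the set *S, and
   star_incl is the inclusion of S into *S; its injectivity follows from
   transfer. *)
Record nonstandard_model (S : Type) := NonstandardModel {
  starS : Type;
  star_incl : S -> starS;
  star : superstructure S -> superstructure starS;
  star_individuals :
    star (collect (range (@individual S))) = collect (range (@individual starS));
  extension : forall s, star (individual s) = individual (star_incl s);
  transfer : forall (phi : formula) (A : nat -> superstructure S),
    sat A phi <-> sat (fun i => star (A i)) phi
}.
Arguments star {S} n A.

Definition internal (S : Type) (M : nonstandard_model S)
    (x : superstructure (starS M)) : Prop :=
  exists A, memV x (star M A).

(* The cardinal kappa is given as the cardinality of a type. *)
Definition saturated (S : Type) (M : nonstandard_model S) (kappa : Type) : Prop :=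
  forall F : set (superstructure (starS M)),
    (forall A, F A -> internal A /\ is_set A) ->
    (F #<= [set: kappa])%card ->
    finI F (@elements (starS M)) ->
    \bigcap_(A in F) elements A !=set0.

Definition card_lt (T U : Type) (A : set T) (B : set U) : Prop :=
  (A #<= B)%card /\ ~ (B #<= A)%card.

Section Transfer.
Variables (S : Type) (M : nonstandard_model S).
Local Notation V := (superstructure S).
Local Notation "*( A )" := (star M A) (format "*( A )").

(* p = (u, v); variables from k on are used as bound variables. *)
Definition fOpair (p u v k : nat) : formula :=
  let s := k in let t := k.+1 in let w := k.+2 in
  fEx s p (fEx t p (fAnd (fAll w p (fOr (fEq w s) (fEq w t)))
    (fAnd (fAnd (fMem u s) (fAll w s (fEq w u)))
      (fAnd (fAnd (fMem u t) (fMem v t)) (fAll w t (fOr (fEq w u) (fEq w v))))))).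

Definition fApp (f u v k : nat) : formula :=
  fEx k f (fOpair k u v k.+1).

Lemma sat_fOpair (S' : Type) (e : nat -> superstructure S') p u v k :
  p < k -> u < k -> v < k ->
  sat e (fOpair p u v k) <-> e p = opair (e u) (e v).
Proof.
move=> pk uk vk; rewrite /= /assign !eqxx.
have N0 i : i < k -> (i == k) = false by move=> ?; apply/eqP; lia.
have N1 i : i < k.+1 -> (i == k.+1) = false by move=> ?; apply/eqP; lia.
have N2 i : i < k.+2 -> (i == k.+2) = false by move=> ?; apply/eqP; lia.
rewrite !(N0 _ pk, N0 _ uk, N0 _ vk) !(N1 k) ?(N1 p) ?(N1 u) ?(N1 v); [|lia..].
rewrite !(N2 k) ?(N2 k.+1) ?(N2 u) ?(N2 v); [|lia..].
split.
  move=> [s sp [t tp [ps [[us su] [[ut vt] tuv]]]]].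
  have es : s = upair (e u) (e u).
    apply: set_ext; [exact: mem_is_set us|exact: upair_is_set|].
    apply/seteqP; split=> x; first by move=> /su ->; apply/mem_upair; left.
    by move=> /mem_upair[] ->.
  have et : t = upair (e u) (e v).
    apply: set_ext; [exact: mem_is_set ut|exact: upair_is_set|].
    apply/seteqP; split=> x; first by move=> /tuv ?; apply/mem_upair.
    by move=> /mem_upair[] ->.
  apply: set_ext; [exact: mem_is_set sp|exact: upair_is_set|].
  apply/seteqP; split=> x; first by move=> /ps; rewrite es et => ?; apply/mem_upair.
  by move=> /mem_upair[] ->; rewrite -?es -?et.
move=> ->; exists (upair (e u) (e u)); first by apply/mem_upair; left.
exists (upair (e u) (e v)); first by apply/mem_upair; right.
split; first by move=> x /mem_upair.
split; first by split=> [|x /mem_upair[]//]; apply/mem_upair; left.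
split; last by move=> x /mem_upair.
by split; apply/mem_upair; [left|right].
Qed.

Lemma sat_fApp (S' : Type) (e : nat -> superstructure S') f u v k :
  f < k -> u < k -> v < k ->
  sat e (fApp f u v k) <-> memV (opair (e u) (e v)) (e f).
Proof.
move=> fk uk vk.
have N i : i < k -> (i == k) = false by move=> ik; apply/eqP; lia.
split=> [[p pf /sat_fOpair]|uvf].
  rewrite /assign eqxx !N // => h; rewrite -h //; exact: ltnW.
exists (opair (e u) (e v)) => //; apply/sat_fOpair; [lia..|].
by rewrite /assign eqxx !N.
Qed.

Definition env (T : Type) (s : seq (superstructure T)) : nat -> superstructure T :=
  nth (emptyV T) s.

Lemma star_env (phi : formula) (s : seq V) :
  sat (env s) phi <-> sat (fun i => *(env s i)) phi.
Proof. exact: transfer. Qed.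

Lemma mem_star x A : memV x A <-> memV *(x) *(A).
Proof. exact: (star_env (fMem 0 1) [:: x; A]). Qed.

Lemma star_subset A B :
  elements A `<=` elements B -> elements *(A) `<=` elements *(B).
Proof. by move=> /(star_env (fAll 2 0 (fMem 2 1)) [:: A; B]). Qed.

Lemma star_setI A B C : elements C = elements A `&` elements B ->
  elements *(C) = elements *(A) `&` elements *(B).
Proof.
move=> CAB; apply/seteqP; split.
  by rewrite subsetI; split; apply: star_subset; rewrite CAB => x [].
have /(star_env (fAll 3 0 (fImp (fMem 3 1) (fMem 3 2))) [:: A; B; C]) h :
    sat (env [:: A; B; C]) (fAll 3 0 (fImp (fMem 3 1) (fMem 3 2))).
  by move=> x xA xB; have : elements C x by rewrite CAB.
by move=> x [xA xB]; exact: h.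
Qed.

Lemma star_opair x y : *(opair x y) = opair *(x) *(y).
Proof.
have : sat (env [:: opair x y; x; y]) (fOpair 0 1 2 3) by exact/sat_fOpair.
by move=> /star_env /sat_fOpair E; exact: E.
Qed.

Definition is_function (S' : Type) (F D C : superstructure S') : Prop :=
  [/\ forall p, memV p F ->
        exists2 x, memV x D & exists2 y, memV y C & p = opair x y,
      forall x, memV x D -> exists2 y, memV y C & memV (opair x y) F
    & forall x y z, memV x D -> memV y C -> memV z C ->
        memV (opair x y) F -> memV (opair x z) F -> y = z].

Lemma star_function F D C :
  is_function F D C -> is_function *(F) *(D) *(C).
Proof.
move=> [h1 h2 h3]; split.
- have /(star_env _ [:: F; D; C]) H : sat (env [:: F; D; C])
      (fAll 3 0 (fEx 4 1 (fEx 5 2 (fOpair 3 4 5 6)))).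
    move=> p /h1[x xD [y yC ->]]; exists x => //; exists y => //.
    exact/sat_fOpair.
  by move=> p /H[x xD [y yC /sat_fOpair E]]; exists x => //; exists y => //;
    exact: E.
- have /(star_env _ [:: F; D; C]) H : sat (env [:: F; D; C])
      (fAll 3 1 (fEx 4 2 (fApp 0 3 4 5))).
    by move=> x /h2[y yC xyF]; exists y => //; exact/sat_fApp.
  by move=> x /H[y yC /sat_fApp E]; exists y => //; exact: E.
- have /(star_env _ [:: F; D; C]) H : sat (env [:: F; D; C])
      (fAll 3 1 (fAll 4 2 (fAll 5 2 (fImp (fApp 0 3 4 6) (fImp (fApp 0 3 5 6)
        (fEq 4 5)))))).
    move=> x xD y yC z zC /sat_fApp xy /sat_fApp xz.
    by apply: (h3 x y z) => //; [exact: xy|exact: xz].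
  move=> x y z xD yC zC xy xz.
  by apply: (H x xD y yC z zC); exact/sat_fApp.
Qed.

Lemma appP (S' : Type) (F D C x : superstructure S') : is_function F D C ->
  memV x D -> memV (appV F x) C /\ memV (opair x (appV F x)) F.
Proof.
move=> [h1 h2 h3] /h2[y yC xyF].
have xF := @xgetI _ (emptyV S') [set z | memV (opair x z) F] y xyF.
split=> //; have [x' _ [y' y'C e]] := h1 _ xF.
by rewrite /appV; have [_ ->] := opair_inj e.
Qed.

Lemma app_eq (S' : Type) (F D C x y : superstructure S') : is_function F D C ->
  memV x D -> memV (opair x y) F -> appV F x = y.
Proof.
move=> fF xD xy; have [aC xa] := appP fF xD; have [h1 h2 h3] := fF.
apply: (h3 x) => //; have [x' _ [y' y'C e]] := h1 _ xy.
by have [_ ->] := opair_inj e.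
Qed.

End Transfer.

Section Hull.
Local Open Scope ring_scope.
Variables (S : Type) (M : nonstandard_model S) (R : realType).
Variable iR : {inj [set: R] >-> S}.
Local Notation "*( A )" := (star M A) (format "*( A )").

(* The inclusion of a set T of individuals in S is given by an injection i of
   the type T into S; extV i G is the subset G of T as an element of V(S). *)
Definition extV (T : Type) (i : T -> S) (G : set T) : superstructure S :=
  collect [set individual (i x) | x in G].

Definition graphV (T U : Type) (a : T -> superstructure S)
    (b : U -> superstructure S) (f : T -> U) : superstructure S :=
  collect [set opair (a x) (b (f x)) | x in setT].

(* The operations and the order of R, as elements of V(S). *)
Definition realV (x : R) : superstructure S := individual (iR x).

Definition real2V (x : R * R) : superstructure S := opair (realV x.1) (realV x.2).

Definition subV : superstructure S :=
  graphV real2V realV (fun x => x.1 - x.2).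

Definition absV : superstructure S := graphV realV realV (fun x => `|x|).

Definition ltV : superstructure S :=
  collect [set real2V x | x in [set x : R * R | x.1 < x.2]].

Definition hsub (xi eta : superstructure (starS M)) := appV *(subV) (opair xi eta).

Definition habs (xi : superstructure (starS M)) := appV *(absV) xi.

Definition hlt (xi eta : superstructure (starS M)) : Prop :=
  memV (opair xi eta) *(ltV).

Definition hfinite (xi : superstructure (starS M)) : Prop :=
  exists n : nat, hlt (habs xi) *(realV n%:R).

Definition hnear (xi eta : superstructure (starS M)) : Prop :=
  forall n : nat, hlt (habs (hsub xi eta)) *(realV n.+1%:R^-1).

Definition starT (T : Type) (i : {inj [set: T] >-> S}) : Type :=
  set_type (elements *(extV i setT)).

HB.instance Definition _ (T : Type) (i : {inj [set: T] >-> S}) :=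
  Choice.copy (starT i) (set_type (elements *(extV i setT))).

Definition star_set (T : Type) (i : {inj [set: T] >-> S}) (G : set T) :
  set (starT i) := [set alpha | memV (val alpha) *(extV i G)].

Definition star_fun (T : Type) (i : {inj [set: T] >-> S}) (g : T -> R)
    (alpha : starT i) : superstructure (starS M) :=
  appV *(graphV (fun x => individual (i x)) realV g) (val alpha).

Lemma injT (T : Type) (i : {inj [set: T] >-> S}) : injective i.
Proof. by move=> x y; apply: inj; rewrite inE. Qed.

Lemma image_level0 (T : Type) (i : T -> S) (G : set T) :
  [set individual (i x) | x in G] `<=` @level S 0.
Proof. by move=> _ [x _ <-]; exists (i x). Qed.

Lemma elements_ext (T : Type) (i : T -> S) (G : set T) :
  elements (extV i G) = [set individual (i x) | x in G].
Proof. exact/elements_collect/image_level0. Qed.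

Lemma mem_ext (T : Type) (i : {inj [set: T] >-> S}) (G : set T) (x : T) :
  memV (individual (i x)) (extV i G) <-> G x.
Proof.
have -> : memV (individual (i x)) (extV i G) = elements (extV i G) (individual (i x)).
  by [].
rewrite elements_ext.
split=> [[y Gy e]|Gx]; last by exists x.
by rewrite -(injT (individual_inj e)).
Qed.

Lemma elements_extI (T : Type) (i : {inj [set: T] >-> S}) (G H : set T) :
  elements (extV i (G `&` H)) = elements (extV i G) `&` elements (extV i H).
Proof.
rewrite !elements_ext; apply/seteqP; split.
  by move=> _ [x [Gx Hx] <-]; split; exists x.
move=> _ [[x Gx <-] [y Hy e]].
by exists x => //; split=> //; rewrite -(injT (individual_inj e)).
Qed.

Lemma star_set_setT (T : Type) (i : {inj [set: T] >-> S}) :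
  star_set (i := i) setT = setT.
Proof. by apply/seteqP; split=> // x _; have /set_mem := valP x. Qed.

Lemma star_set_setI (T : Type) (i : {inj [set: T] >-> S}) (G H : set T) :
  star_set (i := i) (G `&` H) = star_set G `&` star_set H.
Proof.
have E := star_setI M (elements_extI i G H).
apply/seteqP; split=> x xGH.
  by have : elements *(extV i (G `&` H)) (val x) by []; rewrite E.
by have : (elements *(extV i G) `&` elements *(extV i H)) (val x) by []; rewrite -E.
Qed.

Section StandardTopology.
Variables (X : topologicalType) (i : {inj [set: X] >-> S}).

Lemma standard_base_cover : \bigcup_(G in @open X) star_set (i := i) G = setT.
Proof.
apply/seteqP; split=> // x _; exists setT; first exact: openT.
by rewrite star_set_setT.
Qed.

Lemma standard_base_join (G H : set X) (t : starT i) : open G -> open H ->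
  star_set G t -> star_set H t -> exists N : set X,
    [/\ open N, star_set N t & star_set (i := i) N `<=` star_set G `&` star_set H].
Proof.
move=> oG oH Gt Ht; exists (G `&` H); split; first exact: openI.
  by rewrite star_set_setI.
by rewrite star_set_setI.
Qed.

(* The standard topology, whose base is {*G : G open}. *)
HB.instance Definition _ := isBaseTopological.Build (starT i)
  standard_base_cover standard_base_join.

End StandardTopology.

Definition closeV (c : R) : superstructure S :=
  collect [set real2V x | x in [set x : R * R | `|x.1 - x.2| < c]].

Local Notation RV := (extV iR setT).

Definition RRV : superstructure S := collect (range real2V).

Lemma real2V_level (G : set (R * R)) : [set real2V x | x in G] `<=` @level S 2.
Proof. by move=> _ [x _ <-]; apply: level_opair; exact/imageT. Qed.

Lemma real2V_inj : injective real2V.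
Proof.
move=> [x y] [x' y'] /opair_inj /= [e e'].
by rewrite (injT (individual_inj e)) (injT (individual_inj e')).
Qed.

Lemma mem_real2V (G : set (R * R)) (x : R * R) :
  memV (real2V x) (collect [set real2V x | x in G]) <-> G x.
Proof.
rewrite (mem_collect _ (@real2V_level G)); split; last by exists x.
by move=> [y Gy /real2V_inj <-].
Qed.

Lemma mem_RV x : memV x RV <-> exists r, x = realV r.
Proof.
rewrite (mem_collect _ (@image_level0 R iR setT)).
by split=> [[r _ <-]|[r ->]]; exists r.
Qed.

Lemma mem_RRV x : memV x RRV <-> exists r, x = real2V r.
Proof.
rewrite (mem_collect _ (@real2V_level setT)).
by split=> [[r _ <-]|[r ->]]; exists r.
Qed.

Lemma graph_function (T U : Type) (a : T -> superstructure S)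
    (b : U -> superstructure S) (f : T -> U) (D C : superstructure S) k :
  injective a -> injective b ->
  (forall x, @level S k (a x)) -> (forall y, @level S k (b y)) ->
  (forall x, memV x D <-> exists r, x = a r) ->
  (forall x, memV x C <-> exists r, x = b r) ->
  is_function (graphV a b f) D C.
Proof.
move=> a_inj b_inj ka kb Da Cb.
have gl : [set opair (a x) (b (f x)) | x in setT] `<=` @level S k.+2.
  by move=> _ [x _ <-]; exact: level_opair.
have gP p : memV p (graphV a b f) <-> exists x, p = opair (a x) (b (f x)).
  rewrite (mem_collect _ gl).
  by split=> [[x _ <-]|[x ->]]; exists x.
split.
- move=> _ /gP[x ->]; exists (a x); first by apply/Da; exists x.
  by exists (b (f x)) => //; apply/Cb; exists (f x).
- move=> _ /Da[x ->]; exists (b (f x)); first by apply/Cb; exists (f x).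
  by apply/gP; exists x.
- move=> _ y z /Da[x ->] _ _ /gP[x1 /opair_inj[/a_inj <- ->]].
  by move=> /gP[x2 /opair_inj[/a_inj <- ->]].
Qed.

Lemma realV_inj : injective realV.
Proof. by move=> x y e; exact: injT (individual_inj e). Qed.

Lemma realV_level k x : @level S k (realV x).
Proof. by apply: (@level_le S 0) => //; exact/imageT. Qed.

Lemma real2V_level2 x : @level S 2 (real2V x).
Proof. exact: level_opair (realV_level 0 _) (realV_level 0 _). Qed.

Lemma subV_function : is_function subV RRV RV.
Proof.
exact: graph_function real2V_inj realV_inj real2V_level2 (realV_level 2)
  mem_RRV mem_RV.
Qed.

Lemma absV_function : is_function absV RV RV.
Proof.
exact: graph_function realV_inj realV_inj (realV_level 0) (realV_level 0)
  mem_RV mem_RV.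
Qed.

Lemma fun_function (T : Type) (i : {inj [set: T] >-> S}) (g : T -> R) :
  is_function (graphV (fun x => individual (i x)) realV g) (extV i setT) RV.
Proof.
apply: (@graph_function _ _ _ _ _ _ _ 0) mem_RV => //.
- by move=> x y e; exact: injT (individual_inj e).
- exact: realV_inj.
- by move=> x; exact/imageT.
- exact: realV_level.
- move=> x; rewrite (mem_collect _ (@image_level0 T i setT)).
  by split=> [[r _ <-]|[r ->]]; exists r.
Qed.

Lemma star_fun_real (T : Type) (i : {inj [set: T] >-> S}) (g : T -> R)
  (alpha : starT i) : memV (star_fun g alpha) *(RV).
Proof.
have a : memV (val alpha) *(extV i setT) by have /set_mem := valP alpha.
by have [] := appP (star_function M (fun_function i g)) a.
Qed.

Lemma mem_graph (T U : Type) (a : T -> superstructure S)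
    (b : U -> superstructure S) (f : T -> U) k x y :
  injective a ->
  (forall x, @level S k (a x)) -> (forall y, @level S k (b y)) ->
  memV (opair (a x) y) (graphV a b f) <-> y = b (f x).
Proof.
move=> a_inj ka kb.
have gl : [set opair (a x) (b (f x)) | x in setT] `<=` @level S k.+2.
  by move=> _ [z _ <-]; exact: level_opair.
rewrite (mem_collect _ gl).
by split=> [[z _ /opair_inj[/a_inj -> <-]//]|->]; exists x.
Qed.

Lemma star_RRV xi eta : memV xi *(RV) -> memV eta *(RV) -> memV (opair xi eta) *(RRV).
Proof.
have /(star_env M _ [:: RV; RRV]) H : sat (env [:: RV; RRV])
    (fAll 2 0 (fAll 3 0 (fEx 4 1 (fOpair 4 2 3 5)))).
  move=> _ /mem_RV[x ->] _ /mem_RV[y ->].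
  exists (real2V (x, y)); first by apply/mem_RRV; exists (x, y).
  exact/sat_fOpair.
move=> xiR etaR; have [p pRR /sat_fOpair E] := H xi xiR eta etaR.
by have <- : p = opair xi eta by exact: E.
Qed.

Lemma hnear_closeV xi eta c : memV xi *(RV) -> memV eta *(RV) ->
  hlt (habs (hsub xi eta)) *(realV c) <-> memV (opair xi eta) *(closeV c).
Proof.
move=> xiR etaR.
pose s := [:: RV; RRV; subV; absV; ltV; closeV c; realV c].
pose phi := fAll 7 0 (fAll 8 0 (fAll 9 1 (fAll 10 0 (fAll 11 0
  (fImp (fOpair 9 7 8 12) (fImp (fApp 2 9 10 12) (fImp (fApp 3 10 11 12)
    (fAnd (fImp (fApp 4 11 6 12) (fApp 5 7 8 12))
          (fImp (fApp 5 7 8 12) (fApp 4 11 6 12)))))))))).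
have /(star_env M) H : sat (env s) phi.
  move=> _ /mem_RV[x ->] _ /mem_RV[y ->] q _ d _ a _ /sat_fOpair qxy.
  have {qxy} -> : q = real2V (x, y) by exact: qxy.
  move=> /sat_fApp h.
  have {h} -> : d = realV (x - y).
    apply/(mem_graph (fun x => x.1 - x.2) (x, y) d real2V_inj real2V_level2 (realV_level 2)).
    exact: h.
  move=> /sat_fApp h.
  have {h} -> : a = realV `|x - y|.
    apply/(mem_graph (fun x => `|x|) (x - y) a realV_inj (realV_level 0) (realV_level 0)).
    exact: h.
  have E : memV (opair (realV `|x - y|) (realV c)) ltV <->
      memV (opair (realV x) (realV y)) (closeV c).
    by split=> [/(mem_real2V _ (_, _)) h|/(mem_real2V _ (_, _)) h];
      apply/(mem_real2V _ (_, _)).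
  by split=> /sat_fApp h; apply/sat_fApp => //; apply/E; exact: h.
have xieta := star_RRV xiR etaR.
have [dR xied] := appP (star_function M subV_function) xieta.
have [aR xiea] := appP (star_function M absV_function) dR.
pose e := assign (assign (assign (assign (assign (fun i => *(env s i)) 7 xi)
  8 eta) 9 (opair xi eta)) 10 (hsub xi eta)) 11 (habs (hsub xi eta)).
have E1 : sat e (fApp 4 11 6 12) <-> hlt (habs (hsub xi eta)) *(realV c).
  exact: sat_fApp.
have E2 : sat e (fApp 5 7 8 12) <-> memV (opair xi eta) *(closeV c).
  exact: sat_fApp.
have [||| H1 H2] := H xi xiR eta etaR _ xieta _ dR _ aR.
- exact/sat_fOpair.
- exact/sat_fApp.
- exact/sat_fApp.
- by split=> h; [apply/E2/H1/E1 | apply/E1/H2/E2].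
Qed.

Lemma hnear_refl xi : memV xi *(RV) -> hnear xi xi.
Proof.
move=> xiR n; apply/hnear_closeV => //.
pose c : R := n.+1%:R^-1.
have /(star_env M) H : sat (env [:: RV; closeV c]) (fAll 2 0 (fApp 1 2 2 3)).
  move=> _ /mem_RV[x ->]; apply/sat_fApp => //.
  by apply/(mem_real2V _ (x, x)); rewrite /= subrr normr0 invr_gt0.
by have /sat_fApp E := H xi xiR; exact: E.
Qed.

Lemma hnear_sym xi eta : memV xi *(RV) -> memV eta *(RV) ->
  hnear xi eta -> hnear eta xi.
Proof.
move=> xiR etaR xieta n; apply/hnear_closeV => //.
have {}xieta := (hnear_closeV _ xiR etaR).1 (xieta n).
pose c : R := n.+1%:R^-1.
have /(star_env M) H : sat (env [:: RV; closeV c])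
    (fAll 2 0 (fAll 3 0 (fImp (fApp 1 2 3 4) (fApp 1 3 2 4)))).
  move=> _ /mem_RV[x ->] _ /mem_RV[y ->] /sat_fApp h; apply/sat_fApp => //.
  apply/(mem_real2V _ (y, x)); rewrite /= distrC.
  by apply/(mem_real2V [set x | `|x.1 - x.2| < c] (x, y)); exact: h.
pose e := assign (assign (fun i => *(env [:: RV; closeV c] i)) 2 xi) 3 eta.
have {}H : sat e (fApp 1 2 3 4) -> sat e (fApp 1 3 2 4) := H xi xiR eta etaR.
have /H/sat_fApp E : sat e (fApp 1 2 3 4) by exact/sat_fApp.
exact: E.
Qed.

Lemma hnear_trans xi eta zeta : memV xi *(RV) -> memV eta *(RV) ->
  memV zeta *(RV) -> hnear xi eta -> hnear eta zeta -> hnear xi zeta.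
Proof.
move=> xiR etaR zetaR xieta etazeta n; apply/hnear_closeV => //.
have {}xieta := (hnear_closeV _ xiR etaR).1 (xieta n.*2.+1).
have {}etazeta := (hnear_closeV _ etaR zetaR).1 (etazeta n.*2.+1).
pose c : R := n.+1%:R^-1; pose d : R := n.*2.+2%:R^-1.
have cd : c = d + d.
  rewrite /c /d -doubleS -muln2 natrM invfM; exact: splitr.
have /(star_env M) H : sat (env [:: RV; closeV c; closeV d])
    (fAll 3 0 (fAll 4 0 (fAll 5 0 (fImp (fApp 2 3 4 6) (fImp (fApp 2 4 5 6)
      (fApp 1 3 5 6)))))).
  move=> _ /mem_RV[x ->] _ /mem_RV[y ->] _ /mem_RV[z ->].
  move=> /sat_fApp h1 /sat_fApp h2; apply/sat_fApp => //.
  have {}h1 : `|x - y| < d.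
    by apply/(mem_real2V [set x | `|x.1 - x.2| < d] (x, y)); exact: h1.
  have {}h2 : `|y - z| < d.
    by apply/(mem_real2V [set x | `|x.1 - x.2| < d] (y, z)); exact: h2.
  apply/(mem_real2V _ (x, z)); rewrite /= cd.
  by rewrite -(subrKA y); apply: le_lt_trans (ler_normD _ _) _; exact: ltrD.
pose e := assign (assign (assign
  (fun i => *(env [:: RV; closeV c; closeV d] i)) 3 xi) 4 eta) 5 zeta.
have {}H : sat e (fApp 2 3 4 6) -> sat e (fApp 2 4 5 6) -> sat e (fApp 1 3 5 6) :=
  H xi xiR eta etaR zeta zetaR.
have /H {}H : sat e (fApp 2 3 4 6) by exact/sat_fApp.
have /H/sat_fApp E : sat e (fApp 2 4 5 6) by exact/sat_fApp.
exact: E.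
Qed.

Section Phi.
Local Open Scope quotient_scope.
Variables (X : topologicalType) (iX : {inj [set: X] >-> S}) (Phi : set (X -> R)).

Definition finite_points : set (starT iX) :=
  [set alpha | forall g, Phi g -> hfinite (star_fun g alpha)].

Definition hull_rel : rel finite_points :=
  fun alpha beta => `[< forall g, Phi g ->
    hnear (star_fun g (val alpha)) (star_fun g (val beta)) >].

Lemma hull_rel_equiv : equiv_class_of hull_rel.
Proof.
split=> [a|a b|b a c].
- by apply/asboolP => g _; apply/hnear_refl/star_fun_real.
- by apply/asboolP/asboolP => h g Pg; apply: hnear_sym (h g Pg);
    exact: star_fun_real.
- move=> /asboolP ab /asboolP bc; apply/asboolP => g Pg.
  by apply: hnear_trans (ab g Pg) (bc g Pg); exact: star_fun_real.
Qed.

Canonical hull_equiv := EquivRelPack hull_rel_equiv.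

Definition hull : topologicalType :=
  quotient_topology {eq_quot hull_equiv}.

End Phi.
End Hull.

Definition homeomorphic (X Y : topologicalType) : Prop :=
  exists (f : X -> Y) (g : Y -> X),
    [/\ cancel f g, cancel g f, continuous f & continuous g].

(* psi need not be injective. *)
Definition hausdorff_compactification (X K : topologicalType) (psi : X -> K) :
  Prop :=
  [/\ compact [set: K], hausdorff_space K, continuous psi & dense (range psi)].

(* Main.v *)
From Pilot Require Import Defs.
From HB Require Import structures.
From mathcomp Require Import all_boot all_order all_algebra.
From mathcomp Require Import all_classical all_reals.
From mathcomp Require Import topology normedtype.
Set Implicit Arguments.
Unset Strict Implicit.
Unset Printing Implicit Defensive.

Import Order.TTheory GRing.Theory Num.Theory.
Import numFieldNormedType.Exports.
(* Num.Theory also contains a realV. *)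
Import Pilot.Defs.
Local Open Scope classical_set_scope.

(* A point alpha of *X determines the ultrafilter {G : alpha \in *G} on X, and its
   image under psi converges to a unique point st alpha of the compact Hausdorff
   space K.  For continuous f, the value *(f \o psi) alpha is infinitely close to
   f (st alpha), so all points are finite and, by Urysohn's lemma, alpha ~ beta
   iff st alpha = st beta.  The map st is continuous because K is regular, closed
   by saturation, and surjective because psi has dense range: it is a quotient
   map with the same fibres as the projection onto the hull. *)

(** * Quotient maps with the same fibres *)

Lemma homeomorphic_quotient (Y Q K : topologicalType) (p : Y -> Q) (s : Y -> K) :
  (forall U, open (p @^-1` U) -> open U) -> continuous p -> continuous s ->
  (forall C, closed C -> closed (s @` C)) ->
  (forall a b, p a = p b <-> s a = s b) ->
  (forall q, exists a, p a = q) -> (forall k, exists a, s a = k) ->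
  homeomorphic Q K.
Proof.
move=> p_open p_cont s_cont s_closed ps psurj ssurj.
pose sec_p q := projT1 (cid (psurj q)); pose sec_s k := projT1 (cid (ssurj k)).
have sec_pK q : p (sec_p q) = q by exact: projT2 (cid (psurj q)).
have sec_sK k : s (sec_s k) = k by exact: projT2 (cid (ssurj k)).
(* The sections are arbitrary choices; equal fibres make the two composites below independent of
   them. *)
have fp a : s (sec_p (p a)) = s a by apply/ps.
have gs a : p (sec_s (s a)) = p a by apply/ps.
exists (s \o sec_p), (p \o sec_s); split.
- by move=> q /=; rewrite gs.
- by move=> k /=; rewrite fp.
- apply/continuousP => A oA; apply: p_open.
  have -> : p @^-1` ((s \o sec_p) @^-1` A) = s @^-1` A.
    by apply/seteqP; split=> a /=; rewrite fp.
  by move/continuousP: s_cont; exact.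
(* Tested on closed sets because [s] is a closed map: the preimage of [D] is the image under [s] of
   a closed set. *)
- apply/continuous_closedP => D cD.
  have -> : (p \o sec_s) @^-1` D = s @` (p @^-1` D).
    apply/seteqP; split=> [k Dk|_ [a Da <-]]; last by rewrite /= gs.
    by exists (sec_s k).
  by apply: s_closed; move/continuous_closedP: p_cont; exact.
Qed.

(** * The ultrafilter of a nonstandard point *)

Section StarSet.
Variables (S : Type) (M : nonstandard_model S) (T : Type).
Variable i : {inj [set: T] >-> S}.

Lemma star_setS (G H : set T) (alpha : starT M i) :
  G `<=` H -> star_set G alpha -> star_set H alpha.
Proof.
move=> GH; apply: star_subset; rewrite !elements_ext => _ [x Gx <-].
by exists x => //; exact: GH.
Qed.

(** Every member of the empty set differs from itself; by transfer so would every member of its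
    star. *)
Lemma star_set0 (alpha : starT M i) : ~ star_set set0 alpha.
Proof.
have /(star_env M) H : sat (env [:: extV i set0]) (fAll 1 0 (fNot (fEq 1 1))).
  move=> x; rewrite -[memV _ _]/(elements (extV i set0) x).
  by rewrite elements_ext => -[].
by move=> /H; apply.
Qed.

Lemma star_setU (G H : set T) (alpha : starT M i) :
  star_set (G `|` H) alpha -> star_set G alpha \/ star_set H alpha.
Proof.
have /(star_env M) E : sat (env [:: extV i (G `|` H); extV i G; extV i H])
    (fAll 3 0 (fOr (fMem 3 1) (fMem 3 2))).
  move=> x; rewrite -[memV _ _]/(elements (extV i (G `|` H)) x).
  by rewrite elements_ext => -[y [Gy|Hy] <-]; [left|right]; apply/mem_ext.
exact: E.
Qed.

Lemma star_setC (G : set T) (alpha : starT M i) :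
  star_set (~` G) alpha <-> ~ star_set G alpha.
Proof.
split=> [nG G'|nG].
  by apply: (@star_set0 alpha); rewrite -(setICr G) star_set_setI.
have : star_set (G `|` ~` G) alpha by rewrite setUv star_set_setT.
by move=> /star_setU[].
Qed.

Definition star_filter (alpha : starT M i) : set_system T :=
  [set G | star_set G alpha].

Lemma star_filter_proper (alpha : starT M i) : ProperFilter (star_filter alpha).
Proof.
split; first exact: star_set0.
split=> [|G H|G H GH]; rewrite /star_filter /=.
- by rewrite star_set_setT.
- by rewrite star_set_setI.
- exact: star_setS.
Qed.

(** * Values of extended functions and the hyperreals *)

Section StarFun.
Local Open Scope ring_scope.
Variables (R : realType) (iR : {inj [set: R] >-> S}).

Lemma star_realV (x : R) : memV (star M (realV iR x)) (star M (extV iR setT)).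
Proof. by apply/(mem_star M _ _)/mem_RV; exists x. Qed.

Lemma mem_graph_real (g : T -> R) (x : T) y :
  memV (opair (individual (i x)) y)
    (graphV (fun x => individual (i x)) (realV iR) g) <-> y = realV iR (g x).
Proof.
have iI : injective (fun x => individual (i x)).
  by move=> u v e; exact: injT (individual_inj e).
have iL u : @level S 0 (individual (i u)) by exact/imageT.
by have := mem_graph g x y iI iL (realV_level iR 0).
Qed.

Lemma star_fun_graph (g : T -> R) (alpha : starT M i) :
  memV (opair (val alpha) (star_fun iR g alpha))
    (star M (graphV (fun x => individual (i x)) (realV iR) g)).
Proof.
have a : memV (val alpha) (star M (extV i setT)) by have /set_mem := valP alpha.
by have [] := appP (star_function M (fun_function iR i g)) a.
Qed.

Lemma star_fun_near (g : T -> R) (r c : R) (alpha : starT M i) :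
  star_set [set x | `|g x - r| < c] alpha ->
  hlt iR (habs iR (hsub iR (star_fun iR g alpha) (star M (realV iR r))))
    (star M (realV iR c)).
Proof.
(* The standard relation [closeV] replaces hyperreal subtraction and absolute value, so the formula
   to transfer only says that [g x = y] implies that [y] is [c]-close to [r]. *)
move=> ga; apply/hnear_closeV; [exact: star_fun_real|exact: star_realV|].
pose s := [:: extV i [set x | `|g x - r| < c]; extV iR setT;
  graphV (fun x => individual (i x)) (realV iR) g; closeV iR c; realV iR r].
have /(star_env M) H : sat (env s)
    (fAll 5 0 (fAll 6 1 (fImp (fApp 2 5 6 7) (fApp 3 6 4 7)))).
  move=> x; rewrite -[memV _ _]/(elements (extV i _) x) elements_ext.
  move=> -[{}x gx <-] y _ /sat_fApp h.
  have {h} -> : y = realV iR (g x) by apply/mem_graph_real; exact: h.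
  by apply/sat_fApp => //; apply/(mem_real2V _ _ (_, _)).
pose e := assign (assign (fun j => star M (env s j)) 5 (val alpha)) 6
  (star_fun iR g alpha).
have {}H : sat e (fApp 2 5 6 7) -> sat e (fApp 3 6 4 7) :=
  H _ ga _ (star_fun_real iR g alpha).
have /H/sat_fApp E : sat e (fApp 2 5 6 7).
  by apply/sat_fApp => //; exact: star_fun_graph.
exact: E.
Qed.

Lemma star_fun_lt (g : T -> R) (c : R) (alpha : starT M i) :
  star_set [set x | `|g x| < c] alpha ->
  hlt iR (habs iR (star_fun iR g alpha)) (star M (realV iR c)).
Proof.
move=> ga.
have gR := star_fun_real iR g alpha.
have [aR ag] := appP (star_function M (absV_function iR)) gR.
pose s := [:: extV i [set x | `|g x| < c]; extV iR setT;
  graphV (fun x => individual (i x)) (realV iR) g; absV iR; ltV iR; realV iR c].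
have /(star_env M) H : sat (env s)
    (fAll 6 0 (fAll 7 1 (fAll 8 1 (fImp (fApp 2 6 7 9)
      (fImp (fApp 3 7 8 9) (fApp 4 8 5 9)))))).
  move=> x; rewrite -[memV _ _]/(elements (extV i _) x) elements_ext.
  move=> -[{}x gx <-] y _ z _ /sat_fApp h.
  have {h} -> : y = realV iR (g x) by apply/mem_graph_real; exact: h.
  move=> /sat_fApp h.
  have {h} -> : z = realV iR `|g x|.
    apply/(mem_graph (fun x => `|x|) (g x) z (@realV_inj _ _ iR)
      (realV_level iR 0) (realV_level iR 0)).
    exact: h.
  by apply/sat_fApp => //; apply/(mem_real2V _ _ (_, _)).
pose e := assign (assign (assign (fun j => star M (env s j)) 6 (val alpha)) 7
  (star_fun iR g alpha)) 8 (habs iR (star_fun iR g alpha)).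
have {}H : sat e (fApp 2 6 7 9) -> sat e (fApp 3 7 8 9) -> sat e (fApp 4 8 5 9) :=
  H _ ga _ gR _ aR.
have /H {}H : sat e (fApp 2 6 7 9).
  by apply/sat_fApp => //; exact: star_fun_graph.
have /H/sat_fApp E : sat e (fApp 3 7 8 9) by exact/sat_fApp.
exact: E.
Qed.

Lemma hnear_realV (x y : R) :
  hnear (M := M) iR (star M (realV iR x)) (star M (realV iR y)) -> x = y.
Proof.
(* If [x] and [y] differ, the Archimedean property gives [n] with [n.+1%:R^-1] below their distance.
   Nearness at this [n] concerns a standard pair, so it descends to the reals and contradicts
   this. *)
move=> xy; apply/eqP; rewrite -subr_eq0 -normr_le0 leNgt; apply/negP.
move=> /ltr_add_invr[n]; rewrite add0r; apply/negP; rewrite -leNgt ltW //.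
have /hnear_closeV := xy n.
move=> /(_ (star_realV _) (star_realV _)).
rewrite -star_opair => xyc.
have {}xyc := (mem_star M _ _).2 xyc.
by have := (mem_real2V iR [set z : R * R | `|z.1 - z.2| < n.+1%:R^-1] (x, y)).1 xyc.
Qed.

End StarFun.
End StarSet.

(** * The standard topology *)

Section StandardTopologyTheory.
Variables (S : Type) (M : nonstandard_model S) (X : topologicalType).
Variable i : {inj [set: X] >-> S}.

Lemma star_set_open (G : set X) : open G -> open (star_set G : set (starT M i)).
Proof.
by move=> oG; exists [set G]; [move=> _ ->|rewrite bigcup_set1].
Qed.

Lemma standard_nbhsP (alpha : starT M i) (U : set (starT M i)) : open U ->
  U alpha -> exists G : set X, [/\ open G, star_set G alpha & star_set G `<=` U].
Proof.
move=> [D oD <-] [G DG Ga]; exists G; split=> //; first exact: oD.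
exact: bigcup_sup.
Qed.

End StandardTopologyTheory.

(** * The standard part map into the compactification *)

Section StandardPart.
Variables (S : Type) (M : nonstandard_model S) (X K : topologicalType).
Variables (iX : {inj [set: X] >-> S}) (psi : X -> K).
Hypothesis psiP : hausdorff_compactification psi.
Local Notation sX := (starT M iX).

(** By compactness the image filter has a cluster point [k]. If the filter missed the preimage of a
    neighbourhood [V] of [k], it would contain the preimage of the complement, and [V] would have to
    meet its own complement. *)
Lemma standard_part_ex (alpha : sX) :
  exists k : K, forall V, nbhs k V -> star_set (psi @^-1` V) alpha.
Proof.
have [Kc _ _ _] := psiP; have FF := star_filter_proper alpha.
have [//|k [_ kc]] := Kc (psi @ star_filter alpha) _; first exact: filterT.
exists k => V kV; apply: contrapT => /star_setC nV.
by have [x []] := kc (~` V) V nV kV.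
Qed.

Definition standard_part (alpha : sX) : K := projT1 (cid (standard_part_ex alpha)).

Lemma standard_partP (alpha : sX) (V : set K) :
  nbhs (standard_part alpha) V -> star_set (psi @^-1` V) alpha.
Proof. by move: V; exact: projT2 (cid (standard_part_ex alpha)). Qed.

Lemma standard_part_closed (alpha : sX) (D : set K) :
  closed D -> star_set (psi @^-1` D) alpha -> D (standard_part alpha).
Proof.
move=> cD Da; apply: contrapT => nD.
have /standard_partP : nbhs (standard_part alpha) (~` D).
  by apply: open_nbhs_nbhs; split=> //; exact: closed_openC.
by rewrite preimage_setC => /star_setC.
Qed.

(** Limits in a Hausdorff space are unique: neighbourhoods [U] and [V] of the two points meet, since
    the star of the preimage of their intersection contains [alpha]. *)
Lemma standard_part_eq (alpha : sX) (k : K) :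
  (forall V, nbhs k V -> star_set (psi @^-1` V) alpha) -> standard_part alpha = k.
Proof.
move=> kP; have [_ Kh _ _] := psiP; apply: Kh => U V kU kV.
have : star_set (psi @^-1` (U `&` V)) alpha.
  by rewrite preimage_setI star_set_setI; split; [exact: standard_partP|exact: kP].
apply: contraPP => UV0; suff -> : psi @^-1` (U `&` V) = set0 by exact: star_set0.
by apply/seteqP; split=> // x UVx; apply: UV0; exists (psi x).
Qed.

Lemma standard_part_continuous : continuous standard_part.
Proof.
have [Kc Kh psic _] := psiP.
(* For [beta] in the star of the preimage of [U], the standard part is only known to lie in the
   closure of [U]; regularity keeps that closure inside [W]. *)
move=> alpha W nW; have [V nV VW] := compact_regular Kh Kc filterT nW.
have := nV; rewrite nbhsE => -[U [oU Ua] UV].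
rewrite nbhsE; exists (star_set (psi @^-1` U)).
  split; first by apply: star_set_open; move/continuousP: psic; exact.
  by apply: standard_partP; exact: open_nbhs_nbhs.
move=> beta Ub; apply: VW; apply: standard_part_closed; first exact: closed_closure.
by apply: (star_setS _ Ub) => x /UV; exact: subset_closure.
Qed.

(* The family of internal sets is indexed by the open sets G of X: G stands for
   *G when G is the preimage of a neighbourhood of k, and for *(~` G) when *G
   misses C; the two cases exclude each other. *)
Lemma standard_part_closed_map (kappa : Type) (C : set sX) :
  (@open X #<= [set: kappa])%card -> saturated M kappa ->
  closed C -> closed (standard_part @` C).
Proof.
have [Kc Kh psic _] := psiP.
move=> Xk Msat cC k kC.
pose A := [set G : set X | exists2 V, open_nbhs k V & G = psi @^-1` V].
pose B := [set G : set X | open G /\ star_set G `&` C = set0].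
pose h (G : set X) := star M (extV iX (if G \in A then G else ~` G)).
(* Finite intersection property: the sets [P V] generate a filter, proper because [k] is in the
   closure of the image of [C], and every [h G] belongs to it. *)
pose P V := [set val alpha | alpha in C `&` standard_part @^-1` V].
pose F := filter_from (nbhs k) P.
have FF : ProperFilter F.
  apply: filter_from_proper; last first.
    by move=> V /kC[_ [[a Ca <-] Va]]; exists (val a), a.
  apply: filter_from_filter; first by exists setT; exact: filterT.
  move=> V W kV kW; exists (V `&` W); first exact: filterI.
  by move=> _ [a [Ca [Va Wa]] <-]; split; exists a.
have hF G : (A `|` B) G -> F (elements (h G)).
  rewrite /h; case: ifPn => [/set_mem[V [oV Vk] ->] _|/negP nA [/mem_set//|[oG GC]]].
    exists V; first exact: open_nbhs_nbhs.
    move=> _ [a [Ca Va] <-]; apply: standard_partP.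
    by apply: open_nbhs_nbhs; split.
  exists setT; first exact: filterT.
  move=> _ [a [Ca _] <-]; apply/star_setC => Ga.
  by rewrite -[False]/(set0 a) -GC.
(* This index puts the whole of [*X] in the family, so the point obtained by saturation lies in
   [*X]. *)
have AT : A setT by exists setT => //; split=> //; exact: openT.
have [||| x xh] := Msat (h @` (A `|` B)).
- move=> _ [G /hF hG <-]; split.
    pose E := extV iX (if G \in A then G else ~` G).
    by exists (upair E E); apply/(mem_star M _ _)/mem_upair; left.
  by have [x /mem_is_set] := filter_ex hG.
- apply: card_le_trans (card_image_le _ _) (card_le_trans _ Xk).
  apply: subset_card_le => G [[V [oV _] ->]|[]//].
  by move/continuousP: psic; exact.
- move=> D' D'h; apply: (@filter_ex _ F); apply: filter_bigI => Y /D'h.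
  by rewrite inE => -[G /hF + <-].
have xX : elements (star M (extV iX setT)) x.
  by have := xh (h setT) (ex_intro2 _ _ _ (or_introl AT) erefl); rewrite /h mem_set.
pose a : sX := exist _ x (mem_set xX).
have ha G : (A `|` B) G -> star_set (if G \in A then G else ~` G) a.
  by move=> ABG; apply: (xh (h G)); exists G.
exists a.
  (* Otherwise a basic open [star_set G] contains [a] and misses [C], while the member of the family
     indexed by [G] is its complement. *)
  apply: contrapT => nCa.
  have [||G [oG Ga GC]] := @standard_nbhsP _ M _ iX a (~` C) => //.
    exact: closed_openC.
  have BG : B G by split=> //; apply/disjoints_subset.
  have := ha G (or_intror BG); case: ifPn => [|_ /star_setC//].
    (* [G] is not in [A]: some point of [C] has its standard part in [V], hence lies in
       [star_set G], which misses [C]. *)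
    move=> /set_mem[V [oV Vk] eG] _.
    have [_ [[b Cb <-] Vb]] := kC _ (open_nbhs_nbhs (conj oV Vk)).
    apply: GC Cb; rewrite eG; apply: standard_partP.
    exact: open_nbhs_nbhs.
apply: standard_part_eq => V; rewrite nbhsE => -[U kU UV].
have AU : A (psi @^-1` U) by exists U.
have := ha _ (or_introl AU); rewrite mem_set // => Ua.
by apply: star_setS Ua => y /UV.
Qed.

(** The range is closed, as the image of the whole space, and contains the dense set [range psi],
    since the star of a standard point [x] has standard part [psi x]. *)
Lemma standard_part_surj (kappa : Type) :
  (@open X #<= [set: kappa])%card -> saturated M kappa ->
  forall k, exists alpha, standard_part alpha = k.
Proof.
have [_ _ _ psid] := psiP.
move=> Xk Msat k; apply: contrapT => nk.
have oC : open (~` range standard_part).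
  apply: closed_openC; apply: standard_part_closed_map Xk Msat _.
  exact: closedT.
have [|y [ny [x _ xy]]] := psid _ _ oC.
  by exists k => -[a _ ak]; apply: nk; exists a.
apply: ny; rewrite -xy.
have xX : elements (star M (extV iX setT)) (star M (individual (iX x))).
  by apply/(mem_star M _ _)/mem_ext.
pose a : sX := exist _ (star M (individual (iX x))) (mem_set xX).
exists a => //; apply: standard_part_eq => V kV.
by apply/(mem_star M _ _)/mem_ext; exact: nbhs_singleton kV.
Qed.

(** * Standard parts and continuous functions *)

Section Functions.
Local Open Scope ring_scope.
Variables (R : realType) (iR : {inj [set: R] >-> S}).

Lemma standard_part_near (f : K -> R) (alpha : sX) : continuous f ->
  hnear iR (star_fun iR (f \o psi) alpha) (star M (realV iR (f (standard_part alpha)))).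
Proof.
move=> fc n; apply: star_fun_near.
have := @standard_partP alpha [set k | `|f k - f (standard_part alpha)| < n.+1%:R^-1].
apply; have := fc (standard_part alpha).
by move=> /cvgr_distC_lt; apply; rewrite invr_gt0.
Qed.

Lemma standard_part_finite (f : K -> R) (alpha : sX) : continuous f ->
  hfinite iR (star_fun iR (f \o psi) alpha).
Proof.
(* This natural number strictly exceeds the absolute value at the standard part, hence also at all
   nearby points. *)
move=> fc; exists (Num.bound `|f (standard_part alpha)|); apply: star_fun_lt.
apply: (@standard_partP alpha [set k | `|f k| < _]).
have /(@cvgr_norm_lt) := fc (standard_part alpha); apply.
by apply: archi_boundP.
Qed.

Lemma standard_part_eqP (alpha beta : sX) :
  standard_part alpha = standard_part beta <->
  (forall f : K -> R, continuous f ->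
    hnear iR (star_fun iR (f \o psi) alpha) (star_fun iR (f \o psi) beta)).
Proof.
have fR f a := star_fun_real (M := M) (i := iX) iR (f \o psi) a.
have rR := star_realV M iR.
split=> [ab f fc|H].
  apply: (hnear_trans _ (rR (f (standard_part beta)))) => //.
    by rewrite -ab; exact: standard_part_near.
  by apply: hnear_sym => //; exact: standard_part_near.
have [Kc Kh _ _] := psiP.
apply: contrapT => ab.
have cl1 (k : K) : closed [set k].
  exact/accessible_closed_set1/hausdorff_accessible.
(* A Urysohn function, 0 at one standard part and 1 at the other; its extension has near values at
   [alpha] and [beta], which forces 0 = 1. *)
have [|f [fc _ f0 f1]] := (uniform_separatorP (R := R) _ _).1
    (normal_uniform_separator (compact_normal Kh Kc) (cl1 (standard_part alpha))
      (cl1 (standard_part beta)) _).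
  by apply/seteqP; split=> // k [/= -> ].
have : f (standard_part alpha) = f (standard_part beta).
  apply: (hnear_realV (M := M) (iR := iR)); apply: (hnear_trans _ (fR f beta)) => //.
    apply: (hnear_trans _ (fR f alpha)) => //; last exact: H.
    by apply: hnear_sym => //; exact: standard_part_near.
  exact: standard_part_near.
have -> : f (standard_part alpha) = 0 by apply: f0; exists (standard_part alpha).
have -> : f (standard_part beta) = 1 by apply: f1; exists (standard_part beta).
by move/eqP; rewrite eq_sym oner_eq0.
Qed.

End Functions.
End StandardPart.

(** * The hull as a quotient of [*X] *)

Theorem mainTheorem6 (R : realType) (X K : topologicalType) (psi : X -> K)
    (S : Type) (iX : {inj [set: X] >-> S}) (iK : {inj [set: K] >-> S})
    (iR : {inj [set: R] >-> S}) (M : nonstandard_model S) (kappa : Type) :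
  hausdorff_compactification psi ->
  infinite_set [set: kappa] ->
  card_lt (@open X) [set: kappa] ->
  card_lt (@open K) [set: kappa] ->
  saturated M kappa ->
  homeomorphic
    (hull M iR iX [set f \o psi | f in [set f : K -> R | continuous f]]) K.
Proof.
move=> psiP _ [Xk _] _ Msat.
set Phi := [set _ | _ in _].
have fin (alpha : starT M iX) : finite_points iR Phi alpha.
  by move=> _ [f fc <-]; exact: (standard_part_finite psiP).
(* All points being finite, [j] is inverse to the inclusion of [finite_points] into [*X]. *)
pose j (alpha : starT M iX) : finite_points iR Phi := exist _ alpha (mem_set (fin alpha)).
pose p (alpha : starT M iX) : hull M iR iX Phi :=
  (\pi_(hull M iR iX Phi) (j alpha))%qT.
have valj (a : finite_points iR Phi) : j (val a) = a by exact: val_inj.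
apply: (@homeomorphic_quotient _ _ _ p (standard_part psiP)).
- move=> U oU; rewrite /open /= /quotient_open.
  (* An open set of the subspace is the trace of an open set of [*X]; here that set is the preimage
     under [p]. *)
  exists (p @^-1` U) => //.
  by apply/seteqP; split=> a; rewrite /preimage /= /p valj.
- move=> a; apply: (@continuous_comp _ _ _ j (\pi_(hull M iR iX Phi))%qT);
    last exact: pi_continuous.
  move: a; apply: continuous_comp_initial; by move=> a U.
- exact: standard_part_continuous.
- by move=> C; exact: standard_part_closed_map Xk Msat.
- move=> a b; apply: iff_trans (iff_sym (standard_part_eqP psiP iR a b)).
  split=> [/eqmodP/asboolP ab f fc|ab]; first by apply: ab; exists f.
  by apply/eqmodP/asboolP => _ [f fc <-]; exact: ab.
- by move=> q; exists (val (repr q)); rewrite /p valj reprK.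
- exact: standard_part_surj Xk Msat.
Qed.
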